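(* Let $A\in\mathbb{Z}^{m\times n}$, $b\in\mathbb{Z}^m$ and assume that $\Omega:=\{x\in\mathbb{R}^n\mid Ax=b,\ x\geq 0\}$ is compact. Let $\alpha\in\mathbb{N}^n$ and $\beta\in\mathbb{N}$ be such that $$\widehat{A}_{jk}:=A_{jk}+\alpha_k\geq 0,\qquad \widehat{b}_j:=b_j+\beta\geq 0,\qquad k=1,\ldots,n;\ j=1,\ldots,m$$ (so that $\widehat{A}\in\mathbb{N}^{m\times n}$ and $\widehat{b}\in\mathbb{N}^m$), and such that $\beta\geq\rho^*(\alpha)$, where $$\rho^*(\alpha):=\max\Big\{\sum_{j=1}^n\alpha_jx_j\ \Big|\ x\in\Omega\Big\}.$$ Then the following two statements (i) and (ii) are equivalent: (i) The system of linear equations $Ax=b$ has a solution $x\in\mathbb{N}^n$. (ii) The real-valued polynomial $z^b(zy)^\beta-1\in\mathbb{R}[z_1,\ldots,z_m,y]$ can be written $$z^b(zy)^\beta-1\,=\,Q_0(z,y)\,(zy-1)+\sum_{j=1}^nQ_j(z,y)\,\big(z^{A_j}(zy)^{\alpha_j}-1\big)\qquad( * )$$ for some real-valued polynomials $Q_0,Q_1,\ldots,Q_n\in\mathbb{R}[z_1,\ldots,z_m,y]$, all with nonnegative coefficients. In addition, the degree of the $Q_j$'s in $( * )$ is bounded by $$(m+1)\beta+\sum_{j=1}^mb_j-\min\Big[m+1,\ \min_{k=1,\ldots,n}\Big[(m+1)\alpha_k+\sum_{j=1}^mA_{jk}\Big]\Big].$$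
   Context: $\mathbb{N}=\{0,1,2,\ldots\}$. $A_j\in\mathbb{Z}^m$ denotes the $j$-th column of $A$, and $z^{v}:=z_1^{v_1}\cdots z_m^{v_m}$ for $v\in\mathbb{Z}^m$. The symbol $zy$ stands for the monomial $z_1z_2\cdots z_m\,y$; hence $z^b(zy)^\beta=z_1^{b_1+\beta}\cdots z_m^{b_m+\beta}y^\beta$ and $z^{A_j}(zy)^{\alpha_j}=z_1^{A_{1j}+\alpha_j}\cdots z_m^{A_{mj}+\alpha_j}y^{\alpha_j}$, which are genuine monomials of $\mathbb{R}[z_1,\ldots,z_m,y]$ by the conditions on $\alpha,\beta$. Degree means total degree in the variables $z_1,\ldots,z_m,y$. If $\Omega=\emptyset$, then $\rho^*(\alpha)=-\infty$ by convention. The zero polynomial is regarded as satisfying every degree bound (degree $-\infty$). *)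

(* Defs.v *)
From HB Require Import structures.
From mathcomp Require Import all_boot all_order all_algebra.
From mathcomp Require Import all_classical all_reals all_analysis.
(* The notations of mpoly clash with those of MathComp-Analysis. *)
From mathcomp Require Import -(notations) mpoly.
Set Implicit Arguments.
Unset Strict Implicit.
Unset Printing Implicit Defensive.
Import Order.TTheory GRing.Theory Num.Theory.
Import numFieldNormedType.Exports.
Local Open Scope classical_set_scope.
Local Open Scope ring_scope.

Notation "{ 'mpoly' T [ n ] }" := (mpoly n T).

Definition Omega (R : realType) (m n : nat) (A : 'M[int]_(m, n))
    (b : 'cV[int]_m) : set 'cV[R]_n :=
  [set x | map_mx intr A *m x = map_mx intr b /\ forall k, 0 <= x k 0].
Arguments Omega R {m n} A b.

(* For compact Omega the supremum is attained when Omega is nonempty; when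
   Omega is empty, it is -oo. *)
Definition rho_star (R : realType) (m n : nat) (A : 'M[int]_(m, n))
    (b : 'cV[int]_m) (alpha : 'cV[nat]_n) : \bar R :=
  ereal_sup [set (\sum_(k < n) (alpha k 0)%:R * x k 0)%:E | x in Omega R A b].
Arguments rho_star R {m n} A b alpha.

(* In {mpoly R[m.+1]}, the variables z_1, ..., z_m are the first m ones and y is
   the last one. *)
Definition zvar (R : realType) (m : nat) (j : 'I_m) : {mpoly R[m.+1]} :=
  mpolyX R (mnm1 (widen_ord (leqnSn m) j)).
Arguments zvar R {m} j.

Definition yvar (R : realType) (m : nat) : {mpoly R[m.+1]} :=
  mpolyX R (mnm1 ord_max).

Definition zy (R : realType) (m : nat) : {mpoly R[m.+1]} :=
  (\prod_(j < m) zvar R j) * yvar R m.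

(* The monomial z^v (zy)^k = z_1^(v_1 + k) ... z_m^(v_m + k) y^k.  The absolute
   value only turns the exponents into natural numbers: the definition is
   meaningful only when every v_j + k is nonnegative. *)
Definition z_zy_monomial (R : realType) (m : nat) (v : 'cV[int]_m) (k : nat) :
    {mpoly R[m.+1]} :=
  (\prod_(j < m) zvar R j ^+ absz (v j 0 + k%:Z)%R) * yvar R m ^+ k.
Arguments z_zy_monomial R {m} v k.

Definition nonneg_coeffs (R : realType) (m : nat) (p : {mpoly R[m]}) : Prop :=
  forall e : multinom m, 0 <= mcoeff e p.

Definition farkas_representation (R : realType) (m n : nat)
    (A : 'M[int]_(m, n)) (b : 'cV[int]_m) (alpha : 'cV[nat]_n) (beta : nat)
    (Q0 : {mpoly R[m.+1]}) (Q : 'I_n -> {mpoly R[m.+1]}) : Prop :=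
  [/\ nonneg_coeffs Q0,
      forall k, nonneg_coeffs (Q k)
    & z_zy_monomial R b beta - 1 =
        Q0 * (zy R m - 1)
        + \sum_(k < n) Q k * (z_zy_monomial R (col k A) (alpha k 0) - 1)].

(* msize is one more than the total degree; the zero polynomial satisfies every
   bound, including negative ones. *)
Definition degree_le (R : realType) (m : nat) (p : {mpoly R[m]}) (d : int) :
    Prop :=
  p != 0 -> ((msize p).-1)%:Z <= d.

Definition degree_bound (m n : nat) (A : 'M[int]_(m, n)) (b : 'cV[int]_m)
    (alpha : 'cV[nat]_n) (beta : nat) : int :=
  (m.+1)%:Z * beta%:Z + \sum_(j < m) b j 0
  - \big[Num.min/(m.+1)%:Z]_(k < n)
      ((m.+1)%:Z * (alpha k 0)%:Z + \sum_(j < m) A j k).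

(* Main.v *)
Require Import Defs.
From HB Require Import structures.
From mathcomp Require Import all_boot all_order all_algebra.
From mathcomp Require Import all_classical all_reals all_analysis.
From mathcomp Require Import -(notations) mpoly.
From mathcomp Require Import lra.
Set Implicit Arguments.
Unset Strict Implicit.
Unset Printing Implicit Defensive.
Import Order.TTheory GRing.Theory Num.Theory.
Import numFieldNormedType.Exports.
Local Open Scope classical_set_scope.
Local Open Scope ring_scope.

(** Write a monomial as X^u with u a vector of exponents.  All the polynomials
    X^s - 1 of a representation are edges e -> e + s of a graph on exponent
    vectors: multiplying by a polynomial with nonnegative coefficients puts a
    nonnegative flow on the translates of that edge, and an identity
    X^t - 1 = sum_i Q_i (X^(s_i) - 1) says that the resulting flow carries one
    unit from 0 to t.  Such a flow exists if and only if t lies in the monoid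
    generated by the s_i.

    - From monoid to identity ([certificate_comb]): the exponents t which have
      an identity contain 0 and the s_i, and are closed under addition, because
      X^(t+u) - 1 = X^u (X^t - 1) + (X^u - 1).

    - From identity to monoid ([comb_of_certificate]): instead of decomposing
      the flow into paths, apply the cut given by the set of those e from which
      t can be reached.  The sum of the coefficients over this set is at most 0
      on each product Q_i (X^(s_i) - 1), as no edge enters the set; it
      is 1 on X^t - 1 unless 0 belongs to the set, that is, unless t is in the
      monoid.

    - Degrees ([certificate_degree]): when every s_i is nonzero, the terms of
      highest degree in the products Q_i X^(s_i) are nonnegative and cannot be
      cancelled by the -Q_i, which have smaller degree; they survive in
      X^t - 1, whence deg Q_i + deg X^(s_i) <= deg X^t.

    In the theorem, t = (b + beta, beta) and the generators are (1, ..., 1)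
    and (A_k + alpha_k, alpha_k).  Comparing coordinates, t is the combination
    with coefficients x_0, x_1, ..., x_n exactly when A x = b and
    beta = x_0 + sum_k alpha_k x_k ([expo_comb]).  The last equation only
    defines x_0, which is nonnegative because beta >= rho*(alpha).  A generator
    is zero only if A has a zero column, and then a nonempty Omega contains a
    ray and is not compact; as the existence of a representation makes Omega
    nonempty, the degree bound applies to every representation. *)

Local Notation "u +m v" := (mnm_add u v) (at level 50, left associativity).

(** * Polynomials with nonnegative coefficients *)

Section NonnegCoeffs.
Variables (R : realType) (N : nat).
Implicit Types p q : {mpoly R[N]}.

Lemma nonneg_coeffs0 : nonneg_coeffs (0 : {mpoly R[N]}).
Proof. by move=> e; rewrite mcoeff0. Qed.

Lemma nonneg_coeffsX (u : multinom N) : nonneg_coeffs (mpolyX R u).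
Proof. by move=> e; rewrite mcoeffX ler0n. Qed.

Lemma nonneg_coeffsD p q :
  nonneg_coeffs p -> nonneg_coeffs q -> nonneg_coeffs (p + q).
Proof. by move=> p0 q0 e; rewrite mcoeffD addr_ge0. Qed.

Lemma nonneg_coeffsM p q :
  nonneg_coeffs p -> nonneg_coeffs q -> nonneg_coeffs (p * q).
Proof.
by move=> p0 q0 e; rewrite mcoeffM sumr_ge0 // => k _; rewrite mulr_ge0.
Qed.

End NonnegCoeffs.

(** * Nonnegative representations of X^t - 1 and submonoids of exponents *)

Section Certificates.
Variables (R : realType) (N : nat) (I : finType) (s : I -> multinom N).
Implicit Types (t u v : multinom N) (Q : I -> {mpoly R[N]}).

Definition comb (x : I -> nat) : multinom N :=
  \big[@mnm_add N/mnm0]_i mnm_muln (s i) (x i).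

Definition certificate t Q : Prop :=
  (forall i, nonneg_coeffs (Q i))
  /\ mpolyX R t - 1 = \sum_i Q i * (mpolyX R (s i) - 1).

Lemma combE (x : I -> nat) j : comb x j = (\sum_i s i j * x i)%N.
Proof. by rewrite /comb mnm_sumE; apply: eq_bigr => i _; rewrite mulmnE. Qed.

Lemma comb0 : comb (fun=> 0%N) = mnm0.
Proof.
by apply/mnmP => j; rewrite combE mnm0E big1 // => i _; rewrite muln0.
Qed.

Lemma combD_step i (x : I -> nat) :
  comb (fun k => ((k == i) + x k)%N) = s i +m comb x.
Proof.
apply/mnmP => j; rewrite mnmDE !combE.
under eq_bigr => k _ do rewrite mulnDr.
rewrite big_split /=; congr (_ + _)%N.
rewrite (bigD1 i) //= eqxx muln1 big1 ?addn0 // => k /negPf ->.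
by rewrite muln0.
Qed.

Lemma certificate0 : certificate mnm0 (fun=> 0).
Proof.
split=> [i|]; first exact: nonneg_coeffs0.
by rewrite mpolyX0 subrr big1 // => i _; rewrite mul0r.
Qed.

Lemma certificate_step i : certificate (s i) (fun k => (k == i)%:R).
Proof.
split=> [k|].
  by case: eqP => _; [rewrite -mpolyX0; exact: nonneg_coeffsX|
                      exact: nonneg_coeffs0].
rewrite (bigD1 i) //= eqxx mul1r big1 ?addr0 // => k /negPf ->.
by rewrite mul0r.
Qed.

Lemma certificateD t u Q P : certificate t Q -> certificate u P ->
  certificate (t +m u) (fun i => mpolyX R u * Q i + P i).
Proof.
case=> Q0 Qe [P0 Pe]; split=> [i|].
  by apply: nonneg_coeffsD => //; apply: nonneg_coeffsM => //;
     exact: nonneg_coeffsX.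
under eq_bigr => i _ do rewrite mulrDl -mulrA.
rewrite big_split /= -mulr_sumr -Qe -Pe mpolyXD mulrBr mulr1 mulrC.
by rewrite addrA subrK.
Qed.

(** The exponents with a certificate form a submonoid which contains every
    [s i]; unfolding [certificateD] along a path gives a telescoping sum. *)
Lemma certificate_comb (x : I -> nat) : exists Q, certificate (comb x) Q.
Proof.
rewrite /comb; elim/big_ind: _ => [|t u [Q tQ] [P uP]|i _].
- by eexists; exact: certificate0.
- by eexists; exact: (certificateD tQ uP).
- elim: (x i) => [|k [P kP]]; first by eexists; exact: certificate0.
  by rewrite mulmS; eexists; exact: (certificateD (certificate_step i) kP).
Qed.

(** The cut that separates 0 from [t] when [t] is not a combination: it is
    finite, and no translate e -> e + s i of a generator enters it. *)
Definition coreach t : pred (multinom N) :=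
  fun e => `[< exists x, t = e +m comb x >].

(** The sum of the coefficients of [p] on the cut; the degree bound, which
    every element of the cut satisfies, makes the index type finite. *)
Definition mass t (p : {mpoly R[N]}) : R :=
  \sum_(e : bmultinom N (mdeg t).+1 | coreach t e) mcoeff (e : multinom N) p.

Lemma massX t u : mass t (mpolyX R u) = (coreach t u)%:R.
Proof.
rewrite /mass; case: (boolP (coreach t u)) => [tu|tNu]; last first.
  rewrite big1 // => e te; rewrite mcoeffX; case: eqP => // ue.
  by rewrite ue te in tNu.
have ut : (mdeg u < (mdeg t).+1)%N.
  by move: tu => /asboolP[x ->]; rewrite mdegD ltnS leq_addr.
rewrite (bigD1 (BMultinom ut)) //= mcoeffX eqxx big1 ?addr0 //.
move=> e /andP[_ /negP eu]; rewrite mcoeffX; case: eqP => // ue.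
by case: eu; rewrite bmeqP /= ue.
Qed.

Lemma massB t p q : mass t (p - q) = mass t p - mass t q.
Proof. by rewrite -sumrB; apply: eq_bigr => e _; rewrite mcoeffB. Qed.

Lemma massZ t c p : mass t (c *: p) = c * mass t p.
Proof. by rewrite mulr_sumr; apply: eq_bigr => e _; rewrite mcoeffZ. Qed.

Lemma mass_sum t (J : Type) (r : seq J) (F : J -> {mpoly R[N]}) :
  mass t (\sum_(j <- r) F j) = \sum_(j <- r) mass t (F j).
Proof.
rewrite exchange_big /=; apply: eq_bigr => e _.
by rewrite raddf_sum.
Qed.

(** On a monomial X^e, the value is the indicator of e + s i in the cut minus
    that of e, and e belongs to the cut whenever e + s i does. *)
Lemma mass_step_le0 t i (q : {mpoly R[N]}) :
  nonneg_coeffs q -> mass t (q * (mpolyX R (s i) - 1)) <= 0.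
Proof.
move=> q0; rewrite [q]mpolyE mulr_suml mass_sum.
apply: sumr_le0 => e _; rewrite -scalerAl massZ mulrBr mulr1 -mpolyXD.
rewrite massB !massX; apply: mulr_ge0_le0 => //.
rewrite subr_le0 ler_nat; case: (boolP (coreach t _)) => // /asboolP[x te].
suff -> : coreach t e by [].
apply/asboolP; exists (fun k => ((k == i) + x k)%N).
by rewrite combD_step te addmA.
Qed.

(** If 0 were outside the cut of [t], the mass of X^t - 1 would be 1, whereas
    each term of the representation has mass at most 0. *)
Lemma comb_of_certificate t Q : certificate t Q -> exists x, t = comb x.
Proof.
case=> Q0 /(congr1 (mass t)).
rewrite massB -mpolyX0 !massX mass_sum => tQ.
have tt : coreach t t.
  by apply/asboolP; exists (fun=> 0%N); rewrite comb0 addm0.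
case: (boolP (coreach t mnm0)) => [/asboolP[x ->]|/negPf t0].
  by exists x; rewrite add0m.
move: tQ; rewrite tt t0 subr0 => tQ.
have : (true%:R : R) <= 0; last by rewrite ler10.
rewrite tQ; apply: sumr_le0 => i _.
by rewrite mpolyX0; exact: mass_step_le0.
Qed.

(** Take [i] maximizing deg Q_i + deg (s i), and [e] the leading exponent of
    Q_i shifted by [s i].  No Q_k reaches the degree of [e], because its product
    with X^(s k) would exceed the maximum; hence the coefficient of [e] in the
    right-hand side is positive, which forces [e = t]. *)
Lemma certificate_degree t Q : certificate t Q ->
  (forall i, (0 < mdeg (s i))%N) ->
  forall i, Q i != 0 -> ((msize (Q i)).-1 + mdeg (s i) <= mdeg t)%N.
Proof.
case=> Q0 Qe s0 i0 Qi0.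
case: (@arg_maxnP _ i0 (fun i => Q i != 0)
         (fun i => (msize (Q i)).-1 + mdeg (s i))%N Qi0) => i Qi imax.
have {}imax k : Q k != 0 -> ((msize (Q k)).-1 + mdeg (s k)
    <= (msize (Q i)).-1 + mdeg (s i))%N by exact: imax.
apply: leq_trans (imax _ Qi0) _.
rewrite -mlead_deg //= -mdegD; set e := mlead (Q i) +m s i.
have e0 : (0 < mdeg e)%N by rewrite mdegD addn_gt0 s0 orbT.
have Qe0 k : mcoeff e (Q k) = 0.
  apply/eqP; rewrite mcoeff_eq0; case: (eqVneq (Q k) 0) => [->|Qk].
    by rewrite msupp0.
  apply: msize_mdeg_ge; have := imax _ Qk.
  rewrite -(mlead_deg Qi) -(mlead_deg Qk) /= -[leqRHS]mdegD -/e.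
  by apply/leq_trans; rewrite -addn1 leq_add2l s0.
have : 0 < mcoeff e (mpolyX R t - 1).
  rewrite Qe raddf_sum /= (bigD1 i) //=; apply: ltr_wpDr.
    apply: sumr_ge0 => k _; rewrite mulrBr mulr1 mcoeffB Qe0 subr0.
    by apply: nonneg_coeffsM => //; exact: nonneg_coeffsX.
  rewrite mulrBr mulr1 mcoeffB Qe0 subr0 /e addmC mcoeffMX.
  by rewrite lt_def Q0 mleadc_eq0 Qi.
rewrite mcoeffB mcoeffX mcoeff1 -mdeg_eq0 [mdeg e == _]eqn0Ngt e0 subr0.
by case: eqP => [-> //|]; rewrite ltxx.
Qed.

End Certificates.


(** * The monomials z^v (zy)^k *)

Section Exponents.
Variable m : nat.
Implicit Types (v : 'cV[int]_m) (k : nat).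

(** The last coordinate, where [insub] fails, is the exponent of y. *)
Definition expo v k : multinom m.+1 :=
  Multinom [tuple (if insub (i : nat) is Some j then absz (v j 0 + k%:Z)%R
                   else k) | i < m.+1].

Lemma expo_y v k : expo v k ord_max = k.
Proof. by rewrite mnmE insubF //= ltnn. Qed.

Lemma absz_expo_z v k j :
  expo v k (widen_ord (leqnSn m) j) = absz (v j 0 + k%:Z).
Proof. by rewrite mnmE /= valK. Qed.

Lemma expo_z v k j : 0 <= v j 0 + k%:Z ->
  (expo v k (widen_ord (leqnSn m) j))%:Z = v j 0 + k%:Z.
Proof. by move=> vk; rewrite absz_expo_z gez0_abs. Qed.

Lemma mdeg_expo v k : (forall j, 0 <= v j 0 + k%:Z) ->
  (mdeg (expo v k))%:Z = (m.+1)%:Z * k%:Z + \sum_(j < m) v j 0.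
Proof.
move=> vk; rewrite mdegE big_ord_recr /= expo_y PoszD.
rewrite (big_morph _ PoszD (erefl (0 : int))).
under eq_bigr => j _ do rewrite expo_z //.
rewrite big_split /= sumr_const card_ord -mulr_natl natz intS mulrDl mul1r.
by rewrite -addrA addrC [X in _ = X + _]addrC.
Qed.

Lemma z_zy_monomialE (R : realType) v k :
  z_zy_monomial R v k = mpolyX R (expo v k).
Proof.
rewrite mpolyXE_id big_ord_recr /= expo_y; congr (_ * _).
by apply: eq_bigr => j _; rewrite absz_expo_z.
Qed.

Lemma zyE (R : realType) : zy R m = mpolyX R (expo 0 1).
Proof.
rewrite -z_zy_monomialE /z_zy_monomial expr1; congr (_ * _).
by apply: eq_bigr => j _; rewrite mxE add0r expr1.
Qed.

End Exponents.

(** * The generators of a representation *)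

Section OrdCons.
Variables (T : Type) (n : nat) (a : T) (f : 'I_n -> T).

Definition ord_cons (i : 'I_n.+1) : T :=
  if unlift ord0 i is Some k then f k else a.

Lemma ord_cons0 : ord_cons ord0 = a.
Proof. by rewrite /ord_cons unlift_none. Qed.

Lemma ord_consS k : ord_cons (lift ord0 k) = f k.
Proof. by rewrite /ord_cons liftK. Qed.

End OrdCons.

Lemma forall_ordS n (P : 'I_n.+1 -> Prop) :
  P ord0 -> (forall k, P (lift ord0 k)) -> forall i, P i.
Proof. by move=> P0 PS i; case: (unliftP ord0 i) => [k ->|->]. Qed.

Section Steps.
Variables (m n : nat) (A : 'M[int]_(m, n)) (alpha : 'cV[nat]_n).
Hypothesis Ahat_ge0 :
  forall (j : 'I_m) (k : 'I_n), 0 <= A j k + (alpha k 0)%:Z.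

Definition steps : 'I_n.+1 -> multinom m.+1 :=
  ord_cons (expo 0 1) (fun k => expo (col k A) (alpha k 0)).

Lemma farkas_certificate (R : realType) b beta Q0 (Q : 'I_n -> _) :
  farkas_representation A b alpha beta Q0 Q <->
  certificate (R := R) steps (expo b beta) (ord_cons Q0 Q).
Proof.
rewrite /certificate big_ord_recl /steps !ord_cons0 -zyE -z_zy_monomialE.
have -> : \sum_(k < n) ord_cons Q0 Q (lift ord0 k) * (mpolyX R
    (ord_cons (expo 0 1) (fun k => expo (col k A) (alpha k 0)) (lift ord0 k))
    - 1) = \sum_(k < n) Q k * (z_zy_monomial R (col k A) (alpha k 0) - 1).
  by apply: eq_bigr => k _; rewrite !ord_consS z_zy_monomialE.
split=> [[Q0_ge0 Q_ge0 e]|[Q_ge0 e]].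
  by split=> //; apply: forall_ordS => [|k]; rewrite ?ord_cons0 ?ord_consS.
split=> // [|k]; first by have := Q_ge0 ord0; rewrite ord_cons0.
by have := Q_ge0 (lift ord0 k); rewrite ord_consS.
Qed.

(** The y coordinate gives the equation for [beta]; subtracting it from the
    z_j coordinate leaves the j-th equation of A x = b. *)
Lemma expo_comb (b : 'cV[int]_m) beta (x : 'I_n.+1 -> nat) :
  (forall j, 0 <= b j 0 + beta%:Z) ->
  expo b beta = comb steps x <->
  A *m map_mx Posz (\col_k x (lift ord0 k)) = b
  /\ beta = (x ord0 + \sum_k alpha k 0%R * x (lift ord0 k))%N.
Proof.
move=> bhat_ge0.
have yE : comb steps x ord_max
    = (x ord0 + \sum_k alpha k 0%R * x (lift ord0 k))%N.
  rewrite combE big_ord_recl /steps ord_cons0 expo_y mul1n; congr (_ + _)%N.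
  by apply: eq_bigr => k _; rewrite ord_consS expo_y.
have zE j : (comb steps x (widen_ord (leqnSn m) j))%:Z =
    (A *m map_mx Posz (\col_k x (lift ord0 k))) j 0
    + (comb steps x ord_max)%:Z.
  rewrite yE combE big_ord_recl /steps ord_cons0 !PoszD PoszM expo_z;
    last by rewrite mxE.
  rewrite !mxE add0r mul1r addrCA; congr (_ + _).
  rewrite !(big_morph _ PoszD (erefl (0 : int))) -big_split /=.
  apply: eq_bigr => k _; rewrite ord_consS !PoszM expo_z mxE //.
  by rewrite !mxE mulrDl.
split=> [e|[Axb betaE]].
  have betaE : beta = comb steps x ord_max by rewrite -e expo_y.
  split; last by rewrite betaE yE.
  apply/matrixP => j l; rewrite ord1.
  by have := zE j; rewrite -e expo_z // expo_y => /addIr ->.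
have {}betaE : beta = comb steps x ord_max by rewrite yE.
apply/mnmP => i; case: (unliftP ord_max i) => [j ->|->]; last first.
  by rewrite expo_y.
have -> : lift ord_max j = widen_ord (leqnSn m) j.
  by apply: val_inj; rewrite /= /bump leqNgt ltn_ord.
by apply: (can_inj absz_nat); rewrite zE Axb expo_z // -betaE.
Qed.

Lemma nat_solution_Omega (R : realType) b (x : 'cV[nat]_n) :
  A *m map_mx Posz x = b -> Omega R A b (map_mx (fun k => k%:R) x).
Proof.
move=> <-; split=> [|k]; last by rewrite mxE ler0n.
by rewrite map_mxM -map_mx_comp.
Qed.

(** If column k vanishes, then moving along the k-th coordinate direction from
    a point of Omega never leaves Omega, so that coordinate is unbounded. *)
Lemma compact_Omega_col_neq0 (R : realType) b (x : 'cV[R]_n) :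
  compact (Omega R A b) -> Omega R A b x -> forall k, col k A != 0.
Proof.
move=> Ocpt [Ax x_ge0] k; apply/eqP => Ak0.
have : bounded_set [set y k 0 | y in Omega R A b].
  apply: compact_bounded; apply: continuous_compact Ocpt.
  by apply: continuous_subspaceT => y; exact: coord_continuous.
case=> M [_ /(_ (`|M| + 1))]; rewrite (le_lt_trans (ler_norm M)) ?ltrDl //.
move=> /(_ isT) bnd.
have /bnd /= : [set y k 0 | y in Omega R A b] (x k 0 + (`|M| + 2)).
  exists (x + (`|M| + 2) *: delta_mx k 0); last first.
    by rewrite !mxE !eqxx mulr1.
  split=> [|i]; last by rewrite !mxE addr_ge0 // mulr_ge0 // addr_ge0.
  rewrite mulmxDr Ax -scalemxAr -colE -map_col Ak0 map_mx0 scaler0 addr0 //.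
apply/negP; rewrite -ltNge.
by have := x_ge0 k; have := ler_norm (x k 0 + (`|M| + 2)); lra.
Qed.

(** A zero exponent of y forces alpha_k = 0, and then the exponents of the z_j
    are the entries of the k-th column of A. *)
Lemma mdeg_steps_gt0 (R : realType) b (x : 'cV[R]_n) :
  compact (Omega R A b) -> Omega R A b x -> forall i, (0 < mdeg (steps i))%N.
Proof.
move=> Ocpt Ox i; rewrite lt0n mdeg_eq0; apply/eqP; move: i.
apply: forall_ordS => [|k]; rewrite /steps ?ord_cons0 ?ord_consS => e0.
  by have := expo_y (0 : 'cV_m) 1; rewrite e0 mnm0E.
have ak : alpha k 0 = 0%N by rewrite -(expo_y (col k A) (alpha k 0)) e0 mnm0E.
have /eqP[] := compact_Omega_col_neq0 Ocpt Ox k; apply/matrixP => j l.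
rewrite [l]ord1 !mxE; have := @expo_z _ (col k A) (alpha k 0) j.
by have := Ahat_ge0 j k; rewrite e0 mnm0E mxE ak addr0 => Ajk /(_ Ajk).
Qed.

End Steps.

(** * Integer solvability as a nonnegative representation *)

Theorem theorem2 (R : realType) (m n : nat) (A : 'M[int]_(m, n))
    (b : 'cV[int]_m) (alpha : 'cV[nat]_n) (beta : nat)
    (Omega_compact : compact (Omega R A b))
    (Ahat_ge0 : forall (j : 'I_m) (k : 'I_n), 0 <= A j k + (alpha k 0)%:Z)
    (bhat_ge0 : forall j : 'I_m, 0 <= b j 0 + beta%:Z)
    (beta_ge : (rho_star R A b alpha <= (beta%:R)%:E)%E) :
  ((exists x : 'cV[nat]_n, A *m map_mx Posz x = b)
   <->
   (exists (Q0 : {mpoly R[m.+1]}) (Q : 'I_n -> {mpoly R[m.+1]}),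
      farkas_representation A b alpha beta Q0 Q))
  /\
  (forall (Q0 : {mpoly R[m.+1]}) (Q : 'I_n -> {mpoly R[m.+1]}),
     farkas_representation A b alpha beta Q0 Q ->
     degree_le Q0 (degree_bound A b alpha beta)
     /\ forall k : 'I_n, degree_le (Q k) (degree_bound A b alpha beta)).
Proof.
have solution_of_rep (Q0 : {mpoly R[m.+1]}) Q :
    farkas_representation A b alpha beta Q0 Q ->
    exists x : 'cV[nat]_n, A *m map_mx Posz x = b.
  move=> /farkas_certificate /comb_of_certificate[x].
  by move=> /(expo_comb Ahat_ge0 x bhat_ge0)[Axb _]; eexists; exact: Axb.
split; first (split=> [[x Axb]|[Q0 [Q]]]; last exact: solution_of_rep).
  have alphax : (\sum_k alpha k 0%R * x k 0%R <= beta)%N.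
    rewrite -(ler_nat R) -lee_fin; apply: le_trans beta_ge.
    apply: ereal_sup_ubound; eexists; first exact: nat_solution_Omega Axb.
    congr (_%:E); rewrite natr_sum; apply: eq_bigr => k _.
    by rewrite mxE natrM.
  (* The slack of beta over alpha . x is the number of uses of zy. *)
  pose y := ord_cons (beta - \sum_k alpha k 0%R * x k 0%R)%N (x^~ 0).
  have yE : \col_k y (lift ord0 k) = x.
    by apply/matrixP => k l; rewrite mxE /y ord_consS ord1.
  have ty : expo b beta = comb (steps A alpha) y.
    apply/expo_comb => //; rewrite yE; split=> //.
    under eq_bigr => k _ do rewrite /y ord_consS.
    by rewrite /y ord_cons0 subnK.
  have [Q tQ] := certificate_comb R (steps A alpha) y.
  exists (Q ord0), (fun k => Q (lift ord0 k)).
  apply/farkas_certificate; rewrite ty.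
  suff -> : ord_cons (Q ord0) (fun k => Q (lift ord0 k)) = Q by [].
  by apply/funext; apply: forall_ordS => [|k]; rewrite ?ord_cons0 ?ord_consS.
move=> Q0 Q rep; have [x /(nat_solution_Omega R) Ox] :=
  solution_of_rep _ _ rep.
have /certificate_degree/(_ (mdeg_steps_gt0 Ahat_ge0 Omega_compact Ox)) deg :=
  (farkas_certificate _ _ _ _ _ _).1 rep.
have bound d (p : {mpoly R[m.+1]}) :
    ((msize p).-1 + d <= mdeg (expo b beta))%N ->
    \big[Num.min/(m.+1)%:Z]_(k < n)
      ((m.+1)%:Z * (alpha k 0)%:Z + \sum_(j < m) A j k) <= d%:Z ->
    ((msize p).-1)%:Z <= degree_bound A b alpha beta.
  rewrite -lez_nat PoszD mdeg_expo // /degree_bound lerBrDr => pd min_d.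
  by apply: le_trans pd; rewrite lerD2l.
split=> [|k] Qneq0.
  have := deg ord0; rewrite /steps !ord_cons0 => /(_ Qneq0) /bound; apply.
  rewrite mdeg_expo => [|j]; last by rewrite mxE.
  rewrite mulr1 [X in _ + X]big1 => [|j _]; last by rewrite mxE.
  by rewrite addr0; exact: bigmin_le_id.
have := deg (lift ord0 k); rewrite /steps !ord_consS => /(_ Qneq0) /bound.
apply; rewrite mdeg_expo => [|j]; last by rewrite mxE.
rewrite [X in _ <= _ + X](eq_bigr (A^~ k)) => [|j _]; last by rewrite mxE.
exact: (bigmin_le _ k).
Qed.
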